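(* Let $\varepsilon>0$, let $U_f:=\mathrm{span}_{\mathbb{R}^{n_a}}(\{\phi_j\}_{j\in[m]})$ be a finite-dimensional space of $\mathbb{R}^n$-valued functions on $I$ with coefficients $a_j\in\mathbb{R}^{n_a}$ (either real-valued coefficients with vector-valued basis functions, or vector-valued coefficients with real-valued basis functions, as specified in the context), with $\dim(U_f)=n_a\cdot m$ and associated matrix $\Sigma$. For $f_a=\sum_{j=1}^m a_j\phi_j\in U_f$, let $\tilde a=M(a):=a+\frac{1}{\varepsilon}\Sigma^{1/2}Z$, where $Z\sim\mathrm{SLap}(\dim(U_f))$. Then $M$ is $\varepsilon$-GP (with respect to the metric $(a,a')\mapsto\mathrm{dist}_2(f_a,f_{a'})$), and for every $f_a\in U_f$: 1. $\mathbb{E}[\mathrm{dist}_2(f_{\tilde a},f_a)]=\frac{\dim(U_f)}{\varepsilon}$; 2. for every $\beta\in(0,1)$, with probability at least $1-\beta$, $\mathrm{dist}_2(f_{\tilde a},f_a)\le\frac{\eta(\beta;\dim(U_f),1)}{\varepsilon}$, where $\eta(\beta;k,1):=\frac{e}{e-1}\left(k+\ln\frac1\beta\right)$.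
   Context: $I=I_1\times\cdots\times I_d$ with each $I_i\subseteq\mathbb{R}$ (measurable). For square-integrable $f,g:I\to\mathbb{R}^n$ (identified when equal almost everywhere), $\mathrm{dist}_2(f,g):=\left(\int_I\|f(t)-g(t)\|^2\,dt\right)^{1/2}$, with $\|\cdot\|$ the Euclidean norm. $[m]=\{1,\dots,m\}$. The basis functions $\phi_1,\dots,\phi_m$ are square-integrable and linearly independent. The two settings are: (i) Real-valued coefficients ($n_a=1$), basis functions $\phi_j=(\phi_{j,1},\dots,\phi_{j,n}):I\to\mathbb{R}^n$. Here $a=(a_1,\dots,a_m)\in\mathbb{R}^m$, and $\Sigma$ is the inverse of the $m\times m$ matrix $\Sigma^{-1}$ with $[\Sigma^{-1}]_{j,l}=\sum_{r=1}^n\int_I\phi_{j,r}(t)\phi_{l,r}(t)\,dt$. (The case $n=1$ is that of real-valued functions.) (ii) Vector-valued coefficients ($n_a=n$), basis functions $\phi_j:I\to\mathbb{R}$. Here $a_j=(a_{j,1},\dots,a_{j,n})^{\mathsf T}\in\mathbb{R}^n$, the coefficient vector is ordered as $a=(a_{1,1},\dots,a_{m,1},\dots,a_{1,n},\dots,a_{m,n})^{\mathsf T}\in\mathbb{R}^{mn}$, and $\Sigma$ is the inverse of the $mn\times mn$ block-diagonal matrix $\Sigma^{-1}$ whose $n$ diagonal blocks all equal the $m\times m$ matrix $\Sigma_0^{-1}$ with $[\Sigma_0^{-1}]_{j,l}=\int_I\phi_j(t)\phi_l(t)\,dt$. $\Sigma^{1/2}$ is the symmetric positive definite square root of $\Sigma$.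 $\mathrm{SLap}(k)$ is the standard spherical Laplace distribution on $\mathbb{R}^k$, with density $h(z)\propto e^{-\|z\|}$. A randomized mechanism $M:U\to V$ on a metric space $(U,\mathrm{dist})$ is $\varepsilon$-GP ($\varepsilon$-geo-private) if for all $x,x'\in U$ and all measurable $S\subseteq V$, $\Pr[M(x)\in S]\le e^{\varepsilon\,\mathrm{dist}(x,x')}\Pr[M(x')\in S]$. *)

(* Defs.v *)
From HB Require Import structures.
From mathcomp Require Import all_boot all_order all_algebra.
From mathcomp Require Import all_classical all_reals all_analysis.
From mathcomp Require Import mxtens.
Import Order.TTheory GRing.Theory Num.Theory.
Import numFieldNormedType.Exports.

Set Implicit Arguments.
Unset Strict Implicit.
Unset Printing Implicit Defensive.

Local Open Scope classical_set_scope.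
Local Open Scope ring_scope.

(* The points of R^k are the k-tuples of reals, k.-tuple R, whose measurable
   sets are generated by the coordinate projections: the Borel sets.
   The Lebesgue measure on R^k is the k-fold product of the one on R.
   lebesgue_measure lives on measurableTypeR R, which has the same measurable
   sets as R but another display. *)
Section lebesgue_tuple.
Context {R : realType}.

Definition tcons k (p : measurableTypeR R * k.-tuple R) : k.+1.-tuple R :=
  [tuple of (p.1 : R) :: p.2].

Lemma measurable_tcons k : measurable_fun setT (@tcons k).
Proof.
by apply: (@measurable_cons _ _ _ R (fun p => p.1 : R)); [exact: measurable_fst|
  exact: measurable_snd].
Qed.

Section step.
Context k (mu : {sigma_finite_measure set (k.-tuple R) -> \bar R}).

Definition lebesgue_step : set (k.+1.-tuple R) -> \bar R :=
  pushforward (@lebesgue_measure R \x mu)%E (@tcons k).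

Let step0 : lebesgue_step set0 = 0%E.
Proof. by apply: measure0; exact: measurable_tcons. Qed.

Let step_ge0 A : (0 <= lebesgue_step A)%E.
Proof. by apply: measure_ge0; exact: measurable_tcons. Qed.

Let step_sigma_additive : semi_sigma_additive lebesgue_step.
Proof. by apply: measure_semi_sigma_additive; exact: measurable_tcons. Qed.

HB.instance Definition _ := isMeasure.Build _ _ _ lebesgue_step
  step0 step_ge0 step_sigma_additive.

Lemma lebesgue_step_sigma_finite : sigma_finite setT lebesgue_step.
Proof.
have /sigma_finiteP[F [TF ndF Foo]] := sigma_finiteT (@lebesgue_measure R).
have /sigma_finiteP[G [TG ndG Goo]] := sigma_finiteT mu.
pose E n : set (k.+1.-tuple R) :=
  [set t | F n (thead t) /\ G n [tuple of behead t]].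
exists E.
  rewrite predeqE => t; split=> // _.
  have [n _ Fn] : (\bigcup_n F n) (thead t) by rewrite -TF.
  have [p _ Gp] : (\bigcup_n G n) [tuple of behead t] by rewrite -TG.
  exists (maxn n p) => //; split.
    by apply: (subsetPset _ _ (ndF _ _ (leq_maxl n p))).
  by apply: (subsetPset _ _ (ndG _ _ (leq_maxr n p))).
move=> n; have [mF Fn] := Foo n; have [mG Gn] := Goo n; split.
  apply: measurableI; rewrite -[X in measurable X]setTI.
    exact: measurable_tnth.
  exact: measurable_behead.
rewrite (_ : lebesgue_step (E n) = lebesgue_measure (F n) * mu (G n))%E.
  by rewrite lte_mul_pinfty// ge0_fin_numE.
rewrite -product_measure1E //; congr ((_ \x _) _)%E.
by rewrite predeqE => -[x t]; split=> -[? Gt]; split=> //;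
  move: Gt; rewrite /= (_ : [tuple of _] = t)//; exact/val_inj.
Qed.

HB.instance Definition _ :=
  Measure_isSigmaFinite.Build _ _ _ lebesgue_step lebesgue_step_sigma_finite.
End step.

Fixpoint lebesgue_tuple k : {sigma_finite_measure set (k.-tuple R) -> \bar R} :=
  match k with
  | 0 => \d_ ([tuple] : 0.-tuple R)
  | k'.+1 => lebesgue_step (lebesgue_tuple k')
  end.
End lebesgue_tuple.

Section euclidean.
Context {R : realType}.

Definition enorm k (v : k.-tuple R) : R := Num.sqrt (\sum_(i < k) tnth v i ^+ 2).

Definition tsub k (u v : k.-tuple R) : k.-tuple R :=
  [tuple tnth u i - tnth v i | i < k].

Definition box d (J : 'I_d -> set R) : set (d.-tuple R) :=
  [set t | forall i, J i (tnth t i)].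

(* Only meaningful when f - g is square-integrable on I: the real-valued
   integral of a non-integrable function is a junk value. *)
Definition dist2 d n (I : set (d.-tuple R)) (f g : d.-tuple R -> n.-tuple R) : R :=
  Num.sqrt (\int[lebesgue_tuple d]_(t in I) (enorm (tsub (f t) (g t)) ^+ 2)).
End euclidean.

Section spherical_laplace.
Context {R : realType}.

Definition slap_density k (z : k.-tuple R) : R :=
  expR (- enorm z) / \int[lebesgue_tuple k]_y expR (- enorm y).

Definition slap k (A : set (k.-tuple R)) : \bar R :=
  (\int[lebesgue_tuple k]_(z in A) (slap_density z)%:E)%E.
End spherical_laplace.

Section square_root.
Context {R : realType}.

Definition posdefmx k (A : 'M[R]_k) : Prop :=
  A^T = A /\ forall v : 'cV[R]_k, v != 0 -> 0 < (v^T *m A *m v) 0 0.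

(* The symmetric positive definite square root (0 when there is none). *)
Definition sqrtmx k (A : 'M[R]_k) : 'M[R]_k :=
  xget 0 [set S : 'M[R]_k | posdefmx S /\ S *m S = A].
End square_root.

Section privacy.
Context {R : realType}.

Definition is_metric U (dist : U -> U -> R) : Prop :=
  [/\ forall x y, 0 <= dist x y,
      forall x y, dist x y = 0 <-> x = y,
      forall x y, dist x y = dist y x
    & forall x y z, dist x z <= dist x y + dist y z].

(* A randomized mechanism on U with values in V is a family of V-valued random
   variables on (Omega, P), indexed by U. *)
Definition geo_private dO (Omega : measurableType dO) (P : probability Omega R)
    U (dist : U -> U -> R) dV (V : measurableType dV)
    (M : U -> Omega -> V) (eps : R) : Prop :=
  [/\ is_metric dist,
      forall x, measurable_fun setT (M x)
    & forall x x' (S : set V), measurable S ->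
        (P (M x @^-1` S) <= (expR (eps * dist x x'))%:E * P (M x' @^-1` S))%E].
End privacy.

Section function_space.
Context {R : realType} {d n m : nat}.

(* The two settings for f = sum_j a_j phi_j : R^d -> R^n; only the values of
   the basis functions on I matter. *)
Inductive basis_system :=
| RealCoef of 'I_m -> d.-tuple R -> n.-tuple R
| VectorCoef of 'I_m -> d.-tuple R -> R.

Definition dimU (b : basis_system) : nat :=
  match b with RealCoef _ => m | VectorCoef _ => n * m end.

(* With vector coefficients, the r-th coordinate of a_j is stored at the
   position mxtens_index (r, j) = r * m + j of a. *)
Definition comb (b : basis_system) :
    (dimU b).-tuple R -> d.-tuple R -> n.-tuple R :=
  match b return (dimU b).-tuple R -> d.-tuple R -> n.-tuple R with
  | RealCoef phi => fun a t =>
      [tuple \sum_(j < m) tnth a j * tnth (phi j t) r | r < n]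
  | VectorCoef phi => fun a t =>
      [tuple \sum_(j < m) tnth a (mxtens_index (r, j)) * phi j t | r < n]
  end.

Variable I : set (d.-tuple R).
Let mu := @lebesgue_tuple R d.

Definition square_integrable (b : basis_system) : Prop :=
  match b with
  | RealCoef phi => forall j, measurable_fun I (phi j) /\
      (\int[mu]_(t in I) (enorm (phi j t) ^+ 2)%:E < +oo)%E
  | VectorCoef phi => forall j, measurable_fun I (phi j) /\
      (\int[mu]_(t in I) (phi j t ^+ 2)%:E < +oo)%E
  end.

(* Linear independence over R of the classes modulo equality almost everywhere
   on I; it makes a |-> comb a injective modulo that equality, so that dimU is
   the dimension of the space spanned. *)
Definition lin_indep (b : basis_system) : Prop :=
  match b with
  | RealCoef phi => forall c : 'I_m -> R,
      {ae mu, forall t, I t ->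
        forall r, \sum_(j < m) c j * tnth (phi j t) r = 0} ->
      forall j, c j = 0
  | VectorCoef phi => forall c : 'I_m -> R,
      {ae mu, forall t, I t -> \sum_(j < m) c j * phi j t = 0} ->
      forall j, c j = 0
  end.

(* The matrix written Sigma^-1. The Kronecker product 1%:M *t A is the
   block-diagonal matrix with n diagonal blocks equal to A. *)
Definition gram (b : basis_system) : 'M[R]_(dimU b) :=
  match b return 'M[R]_(dimU b) with
  | RealCoef phi => \matrix_(j, l)
      \sum_(r < n) \int[mu]_(t in I) (tnth (phi j t) r * tnth (phi l t) r)
  | VectorCoef phi =>
      (1%:M : 'M[R]_n) *t
      \matrix_(j < m, l < m) \int[mu]_(t in I) (phi j t * phi l t)
  end.

Definition Sigma (b : basis_system) : 'M[R]_(dimU b) := invmx (gram b).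
End function_space.
Arguments basis_system : clear implicits.

Section mechanism.
Context {R : realType}.

(* a + (1 / eps) S z, with a and z read as column vectors. *)
Definition perturb k (eps : R) (S : 'M[R]_k) (a z : k.-tuple R) : k.-tuple R :=
  [tuple tnth a i + eps^-1 * (S *m \col_j tnth z j) i 0 | i < k].

Definition eta1 (beta : R) (k : nat) : R :=
  expR 1 / (expR 1 - 1) * (k%:R + ln (1 / beta)).
End mechanism.

(* Main.v *)
(* Let [S = Sigma^{1/2}], so that [S G S = 1] for the Gram matrix [G = Sigma^-1].
   Since [dist2 (f_a) (f_a') ^+ 2] is the quadratic form [G] at [a - a'], it equals
   [enorm (S^-1 (a - a'))]; hence [dist2 (f_(M a)) (f_a) = enorm Z / eps], and
   changing [a] into [a'] translates [Z] by a vector of norm [eps * dist2 (f_a) (f_a')].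
   Privacy follows from translation invariance of the Lebesgue measure and the
   triangle inequality. Scaling the Lebesgue measure gives the exponential moments
   [E (expR (s * enorm Z)) = (1 - s) ^- k], from which the mean is obtained by
   squeezing and the tail by Chernoff's bound. *)
Require Import Defs.
From HB Require Import structures.
From mathcomp Require Import all_boot all_order all_algebra.
From mathcomp Require Import all_classical all_reals all_analysis.
From mathcomp Require Import measurable_realfun complex mxtens.
From mathcomp Require Import ring lra.
Import Order.TTheory GRing.Theory Num.Theory.
Import numFieldNormedType.Exports.
Local Open Scope classical_set_scope.
Local Open Scope ring_scope.

Set Implicit Arguments.
Unset Strict Implicit.
Unset Printing Implicit Defensive.

(** * Square roots of positive definite matrices *)

(** Newton interpolation: a new node is met by adding a multiple of the product of the ['X - y%:P]
    over the previous nodes, which leaves the values there unchanged. *)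
Lemma poly_interpolation (F : fieldType) (s : seq F) (f : F -> F) :
  exists p : {poly F}, {in s, forall x, p.[x] = f x}.
Proof.
elim: s => [|x s [p pE]]; first by exists 0.
have [xs|xs] := boolP (x \in s).
  by exists p => y; rewrite inE => /predU1P[->|]; exact: pE.
pose q := \prod_(y <- s) ('X - y%:P).
have qx : q.[x] != 0 by move: xs; rewrite -root_prod_XsubC.
exists (p + ((f x - p.[x]) / q.[x])%:P * q) => y.
rewrite inE hornerD hornerM hornerC => /predU1P[->|ys].
  by rewrite divfK// addrC subrK.
have -> : q.[y] = 0 by apply/rootP; rewrite root_prod_XsubC.
by rewrite mulr0 addr0 pE.
Qed.

(** Needed to see that a polynomial in a symmetric matrix is symmetric. *)
Lemma trmx_horner (F : comNzRingType) k (A : 'M[F]_k.+1) (p : {poly F}) :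
  (horner_mx A p)^T = horner_mx A^T p.
Proof.
elim/poly_ind: p => [|p c IH]; first by rewrite !rmorph0 trmx0.
rewrite !rmorphD !rmorphM /= !horner_mx_X !horner_mx_C linearD/= trmx_mul IH.
by rewrite tr_scalar_mx; congr (_ + _); exact: comm_mx_horner.
Qed.

Section posdef.
Context {R : realType}.

Lemma cV_sqr_gt0 k (v : 'cV[R]_k) : v != 0 -> 0 < (v^T *m v) 0 0.
Proof.
move=> v0; rewrite mxE lt_neqAle sumr_ge0 ?andbT; last first.
  by move=> i _; rewrite mxE -expr2 sqr_ge0.
apply: contra v0; rewrite eq_sym psumr_eq0; last first.
  by move=> i _; rewrite mxE -expr2 sqr_ge0.
move=> /allP v0; apply/eqP/matrixP => i j; rewrite ord1 mxE.
by have := v0 i; rewrite mem_index_enum mxE -expr2 sqrf_eq0 => /(_ isT)/eqP.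
Qed.

Lemma posdefmx_eigenvalue_gt0 k (A : 'M[R]_k) (x : R) :
  posdefmx A -> eigenvalue A x -> 0 < x.
Proof.
move=> [_ Apos] /eigenvalueP[v vA v0].
have vT0 : v^T != 0 by rewrite -trmx0 (inj_eq trmx_inj).
have := Apos _ vT0; rewrite trmxK vA -scalemxAl mxE.
by rewrite pmulr_lgt0// -[v in v *m _]trmxK cV_sqr_gt0.
Qed.

(** A nonzero row of the kernel would be a nonzero vector on which the quadratic form vanishes. *)
Lemma posdefmx_unit k (A : 'M[R]_k) : posdefmx A -> A \in unitmx.
Proof.
move=> [_ Apos]; rewrite -row_free_unit -kermx_eq0; apply/eqP/row_matrixP => i.
rewrite row0; apply/eqP/negPn/negP => u0.
have uT0 : (row i (kermx A))^T != 0 by rewrite -trmx0 (inj_eq trmx_inj).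
have := Apos _ uT0.
by rewrite trmxK -row_mul mulmx_ker row0 mul0mx mxE ltxx.
Qed.

(** The form of [invmx A] at [v] is the form of [A] at [invmx A *m v]. *)
Lemma posdefmx_inv k (A : 'M[R]_k) : posdefmx A -> posdefmx (invmx A).
Proof.
move=> Apd; have Au := posdefmx_unit Apd; have [Asym Apos] := Apd; split.
  by rewrite trmx_inv Asym.
move=> v v0; have := Apos (invmx A *m v).
rewrite trmx_mul trmx_inv Asym mulmxKV//; rewrite mulmxA; apply.
by apply: contra v0 => /eqP /(congr1 (mulmx A)); rewrite mulKVmx// mulmx0 => ->.
Qed.

Local Open Scope complex_scope.

(** Over [R[i]] the matrix is Hermitian, so the spectral theorem diagonalises it with real
    eigenvalues. Only [D] is brought back to [R]; the change of basis [P] stays complex. *)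
Lemma sym_mx_diag k (A : 'M[R]_k.+1) : A^T = A ->
  exists (P : 'M[R[i]]_k.+1) (D : 'rV[R]_k.+1), P \in unitmx /\
    map_mx (real_complex R) A =
      P *m diag_mx (map_mx (real_complex R) D) *m invmx P.
Proof.
move=> Asym; pose Ac := map_mx (real_complex R) A.
have Ah : Ac \is hermsymmx.
  apply: realsym_hermsym.
    apply/is_hermitianmxP; rewrite expr0 scale1r; apply/matrixP => i j.
    by rewrite !mxE -[in LHS]Asym mxE.
  by apply/mxOverP => i j; rewrite mxE; apply/complex_realP; exists (A i j).
have Asp := orthomx_spectralP (hermitian_normalmx Ah).
have Pu := spectral_unit Ac; set P := spectralmx Ac in Asp Pu.
have Dr := hermitian_spectral_diag_real Ah.
exists (invmx P), (map_mx (@complex.Re R) (spectral_diag Ac)).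
rewrite unitmx_inv invmxK -map_mx_comp; split => //; rewrite [LHS]Asp.
congr (_ *m diag_mx _ *m _); apply/matrixP => i j.
by rewrite mxE/= RRe_real//; apply/mxOverP.
Qed.

(* The diagonalisation lives over [R[i]], but a real polynomial [p] interpolating
   the fourth root on the (real) spectrum brings [p(A)] back to [R]; starting
   from a fourth root makes positivity of [p(A) ^+ 2] a sum of squares. *)
Lemma posdefmx_root4 k (A : 'M[R]_k.+1) : posdefmx A ->
  exists2 T : 'M[R]_k.+1, T^T = T & T ^+ 4 = A.
Proof.
move=> Apd; have [P [D [Pu AE]]] := sym_mx_diag (proj1 Apd).
have [p pE] := poly_interpolation [seq D 0 i | i <- enum 'I_k.+1]
  (fun x => Num.sqrt (Num.sqrt x)).
have pD i : p.[D 0 i] ^+ 4 = D 0 i.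
  rewrite pE; last by apply: map_f; rewrite mem_enum.
  suff Di0 : 0 < D 0 i.
    by rewrite (exprM _ 2 2) sqr_sqrtr ?sqrtr_ge0// sqr_sqrtr// ltW.
  apply: (posdefmx_eigenvalue_gt0 Apd).
  (* Being an eigenvalue can be tested over [R[i]], where row [i] of [invmx P] is a left
     eigenvector, nonzero since [P] is invertible. *)
  rewrite -(eigenvalue_map (real_complex R)) AE.
  apply/eigenvalueP; exists (row i (invmx P)).
    rewrite !mulmxA -row_mul mulVmx// row1 -rowE row_diag_mx mxE.
    by rewrite -scalemxAl -rowE.
  apply/eqP => /(congr1 (mulmx^~ P)); rewrite -row_mul mulVmx// mul0mx row1.
  by move=> /matrixP/(_ 0 i); rewrite !mxE !eqxx => /eqP; rewrite oner_eq0.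
exists (horner_mx A p); first by rewrite trmx_horner (proj1 Apd).
apply: (map_mx_inj (f := real_complex R)); rewrite [RHS]AE.
rewrite -[_ ^+ 4]rmorphXn/= map_horner_mx AE horner_mx_uconj// horner_mx_diag.
congr (_ *m _ *m _); congr diag_mx; apply/matrixP => i j.
by rewrite !mxE ord1 horner_map/= horner_exp pD.
Qed.

Lemma posdefmx_sqrt k (A : 'M[R]_k) : posdefmx A ->
  exists S : 'M[R]_k, posdefmx S /\ S *m S = A.
Proof.
(* Polynomials in a matrix require a dimension of the form [k.+1]; in dimension 0 all matrices
   coincide. *)
case: k A => [|k] A Apd.
  by exists A; split=> //; apply/matrixP => -[].
have [T Tsym T4] := posdefmx_root4 Apd.
have Tu : T \in unitmx.
  have : T ^+ 4 \is a GRing.unit by rewrite T4; exact: posdefmx_unit.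
  by rewrite unitrX_pos.
exists (T *m T); split; last by rewrite -T4 -[LHS]/((T ^+ 2) ^+ 2) -exprM.
split=> [|v v0]; first by rewrite trmx_mul Tsym.
(* The form of [T *m T] at [v] is the sum of squares of the entries of [T *m v], as [T] is
   symmetric. *)
rewrite mulmxA -mulmxA -{1}Tsym -trmx_mul; apply: cV_sqr_gt0.
by apply: contra v0 => /eqP /(congr1 (mulmx (invmx T))); rewrite mulKmx// mulmx0 => ->.
Qed.

Lemma sqrtmxP k (A : 'M[R]_k) : posdefmx A ->
  posdefmx (sqrtmx A) /\ sqrtmx A *m sqrtmx A = A.
Proof.
by move=> /posdefmx_sqrt[S SA]; rewrite /sqrtmx; case: xgetP => [_ -> //|/(_ S)].
Qed.

End posdef.

(** * Affine changes of variables *)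

Section lebesgue_affine.
Context {R : realType}.
Local Open Scope ereal_scope.

Definition affine (c b : R) (x : measurableTypeR R) : measurableTypeR R := (c * x + b)%R.

Lemma measurable_affine c b : measurable_fun setT (affine c b).
Proof.
apply: (@measurable_funD _ _ _ _ (fun x => c * x)%R (cst b)) => //.
exact: mulrl_measurable.
Qed.

Let affine_image c b : {measure set (measurableTypeR R) -> \bar R} :=
  measure_function_pushforward__canonical__measure_function_Measure
    lebesgue_measure (measurable_affine c b).

(** By uniqueness of the Lebesgue measure, it suffices to compare both sides on the intervals []u,
    v]], whose preimages are again such intervals. *)
Lemma lebesgue_measure_affine (c b : R) (c0 : (0 < c)%R) A : measurable A ->
  lebesgue_measure A = c%:E * lebesgue_measure (affine c b @^-1` A).
Proof.
apply: (lebesgue_measure_unique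
  (mu := mscale (NngNum (ltW c0)) (affine_image c b))) => _ [[u v] _ <-] /=.
rewrite /mscale /= /pushforward.
have -> : affine c b @^-1` `]u, v]%classic =
    `]((u - b) / c)%R, ((v - b) / c)%R]%classic.
  apply/seteqP; split=> x /=; rewrite /affine !in_itv/=;
  by rewrite ltr_pdivrMr// ler_pdivlMr// ltrBlDr lerBrDr (mulrC x).
rewrite !lebesgue_measure_itv/= !lte_fin ltr_pM2r ?invr_gt0// ltrD2r.
case: ifP => _; last by rewrite mule0.
by rewrite -!EFinB -EFinM -mulrBl mulrC divfK ?gt_eqF// opprB addrA subrK.
Qed.

Lemma ge0_integral_affine (c b : R) (f : measurableTypeR R -> \bar R) :
  (0 < c)%R -> measurable_fun setT f -> (forall x, 0 <= f x) ->
  \int[lebesgue_measure]_x f (c * x + b)%R =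
  c^-1%:E * \int[lebesgue_measure]_x f x.
Proof.
move=> c0 mf f0; have maff := measurable_affine c b.
have -> : \int[lebesgue_measure]_x f x =
    \int[mscale (NngNum (ltW c0)) (affine_image c b)]_x f x.
  by apply: eq_measure_integral => A mA _; exact: lebesgue_measure_affine.
rewrite ge0_integral_mscale//= muleA -EFinM mulVf ?gt_eqF// mul1e.
by rewrite ge0_integral_pushforward.
Qed.
End lebesgue_affine.

Section lebesgue_tuple_affine.
Context {R : realType}.
Local Open Scope ereal_scope.

Lemma lebesgue_tupleS k : lebesgue_tuple k.+1 =
  pushforward (@lebesgue_measure R \x lebesgue_tuple k) (@tcons R k) :> (set _ -> _).
Proof. by []. Qed.

(** Tonelli's theorem, the measure on [k.+1] coordinates being the image of a product; it allows
    induction on the dimension. *)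
Lemma ge0_integral_tcons k (f : k.+1.-tuple R -> \bar R) :
  measurable_fun setT f -> (forall z, 0 <= f z) ->
  \int[lebesgue_tuple k.+1]_z f z =
  \int[lebesgue_measure]_x \int[lebesgue_tuple k]_t f (tcons (x, t)).
Proof.
move=> mf f0; rewrite lebesgue_tupleS ge0_integral_pushforward//=.
  rewrite preimage_setT fubini_tonelli1//.
  by apply: measurableT_comp => //; exact: measurable_tcons.
exact: measurable_tcons.
Qed.

Lemma measurable_integral_tcons k (f : k.+1.-tuple R -> \bar R) :
  measurable_fun setT f -> (forall z, 0 <= f z) ->
  measurable_fun setT (fun x => \int[lebesgue_tuple k]_t f (tcons (x, t))).
Proof.
move=> mf f0; apply: (measurable_fun_fubini_tonelli_F (f \o @tcons R k)) => //=.
by apply: measurableT_comp => //; exact: measurable_tcons.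
Qed.

Lemma measurable_tuple_affine k (c : R) (w : k.-tuple R) :
  measurable_fun setT (fun z : k.-tuple R => [tuple (c * tnth z i + tnth w i)%R | i < k]).
Proof.
apply/measurable_fun_tnthP => i.
rewrite (_ : _ \o _ = fun z => (c * tnth z i + tnth w i)%R); last first.
  by apply/funext => z /=; rewrite tnth_mktuple.
apply: measurable_funD => //; apply: measurable_funM => //.
exact: measurable_tnth.
Qed.

(** Induction on [k], with [w] generalised: the induction hypothesis treats the tail of [w], the
    one-dimensional formula its head, and each coordinate contributes a factor [c^-1]. *)
Lemma ge0_integral_tuple_affine k (c : R) (w : k.-tuple R) (f : k.-tuple R -> \bar R) :
  (0 < c)%R -> measurable_fun setT f -> (forall z, 0 <= f z) ->
  \int[lebesgue_tuple k]_z f [tuple (c * tnth z i + tnth w i)%R | i < k] =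
  (c ^- k)%:E * \int[lebesgue_tuple k]_z f z.
Proof.
move=> c0; elim: k w f => [|k IH] w f mf f0.
  rewrite expr0 invr1 mul1e; apply: eq_integral => z _.
  by congr f; apply: eq_from_tnth => -[].
have [x [t wE]] : exists x t, w = tcons (x, t).
  by exists (thead w), [tuple of behead w]; exact: tuple_eta.
rewrite ge0_integral_tcons//; last first.
  by apply: measurableT_comp => //; exact: measurable_tuple_affine.
transitivity (\int[lebesgue_measure]_y ((c ^- k)%:E *
    (fun y' => \int[lebesgue_tuple k]_t f (tcons (y', t))) (c * y + x)%R)).
  apply: eq_integral => y _; rewrite -(IH t); last 2 first.
  - apply: (measurableT_comp mf).
    by apply: (measurableT_comp (@measurable_tcons R k)); exact: pair1_measurable.
  - by move=> z; exact: f0.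
  apply: eq_integral => z _; congr f; apply: eq_from_tnth => i.
  rewrite tnth_mktuple wE /tcons; have [j ->|->] := unliftP ord0 i.
    by rewrite !tnthS tnth_mktuple.
  by rewrite !tnth0.
have mF := measurable_integral_tcons mf f0.
rewrite ge0_integralZl//; last 3 first.
- by apply: (measurableT_comp mF); exact: measurable_affine.
- by move=> y _; exact: integral_ge0.
- by rewrite lee_fin invr_ge0 exprn_ge0// ltW.
rewrite (ge0_integral_affine _ c0 mF); last by move=> y; exact: integral_ge0.
by rewrite muleA -EFinM -invfM -exprSr ge0_integral_tcons.
Qed.
End lebesgue_tuple_affine.

(** * The spherical Laplace distribution *)

Section density.
Context d (T : measurableType d) (R : realType).
Context (mu nu : {measure set T -> \bar R}) (h : T -> R).
Hypotheses (mh : measurable_fun setT h) (h0 : forall x, (0 <= h x)%R).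
Hypothesis nuE : forall A, measurable A -> nu A = (\int[mu]_(x in A) (h x)%:E)%E.
Local Open Scope ereal_scope.
Import HBNNSimple.

(** By linearity this reduces to indicators, where it is the hypothesis [nuE]. *)
Let nnsfun_density (f : {nnsfun T >-> R}) :
  \int[nu]_x (f x)%:E = \int[mu]_x ((f x)%:E * (h x)%:E).
Proof.
under eq_integral do rewrite fimfunE -fsumEFin//.
rewrite ge0_integral_fsum//; last 2 first.
- by move=> r; exact/measurable_EFinP/measurable_funM.
- by move=> r x _; rewrite nnfun_muleindic_ge0.
transitivity (\int[mu]_x \sum_(r \in range f)
    (r%:E * (\1_(f @^-1` [set r]) x * h x)%:E)); last first.
  apply: eq_integral => x _; rewrite fimfunE -fsumEFin// ge0_mule_fsuml//.
    by apply: eq_fsbigr => r _; rewrite -EFinM mulrA.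
  by move=> r; exact: nnfun_muleindic_ge0.
rewrite ge0_integral_fsum//; last 2 first.
- move=> r; apply: measurable_funeM; apply/measurable_EFinP.
  exact: measurable_funM.
- move=> r x _; rewrite EFinM muleA mule_ge0 ?lee_fin//.
  exact: nnfun_muleindic_ge0.
apply: eq_fsbigr => r /[!inE] -[x _ <-{r}].
rewrite integralZl_indic_nnsfun// integral_indic// setIT nuE//.
rewrite ge0_integralZl//.
- rewrite integral_mkcond; congr (_ * _); apply: eq_integral => y _.
  rewrite epatch_indic/= muleC; congr (_%:E).
- by apply/measurable_EFinP; exact: measurable_funM.
- by move=> y _; rewrite lee_fin mulr_ge0.
- by rewrite lee_fin.
Qed.

(** Monotone convergence, applied on both sides to simple functions increasing to [f]. *)
Lemma ge0_integral_density (f : T -> \bar R) :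
  measurable_fun setT f -> (forall x, 0 <= f x) ->
  \int[nu]_x f x = \int[mu]_x (f x * (h x)%:E).
Proof.
move=> mf f0; pose f_ := nnsfun_approx measurableT mf.
have fE x : f x = limn (fun n => (f_ n x)%:E).
  by apply/esym/cvg_lim => //; exact: cvg_nnsfun_approx.
have ndf x : {homo (fun n => (f_ n x)%:E) : m n / (m <= n)%N >-> m <= n}.
  by move=> m n mn; rewrite lee_fin; exact/lefP/nd_nnsfun_approx.
transitivity (limn (fun n => \int[nu]_x (f_ n x)%:E)).
  rewrite -monotone_convergence//.
  - by apply: eq_integral => x _; exact: fE.
  - by move=> n; exact/measurable_EFinP/measurable_funP.
  - by move=> n y _; rewrite lee_fin.
under eq_fun do rewrite nnsfun_density.
rewrite -monotone_convergence//.
- apply: eq_integral => x _; apply/cvg_lim => //.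
  by apply: cvgeZr => //; exact: cvg_nnsfun_approx.
- move=> n; apply/measurable_EFinP; apply: measurable_funM => //.
- by move=> n y _; rewrite -EFinM lee_fin mulr_ge0.
- move=> x _ m n mn; apply: lee_wpmul2r; first by rewrite lee_fin.
  exact: ndf.
Qed.
End density.

(** * The Euclidean norm on tuples *)

Section enorm_theory.
Context {R : realType}.
Implicit Types k : nat.

Lemma enorm_ge0 k (v : k.-tuple R) : 0 <= enorm v.
Proof. exact: sqrtr_ge0. Qed.

Lemma sqr_enorm k (v : k.-tuple R) : enorm v ^+ 2 = \sum_(i < k) tnth v i ^+ 2.
Proof. by rewrite sqr_sqrtr// sumr_ge0// => i _; exact: sqr_ge0. Qed.

Lemma enorm_eq0 k (v : k.-tuple R) : enorm v = 0 -> forall i, tnth v i = 0.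
Proof.
move=> v0 i; have /eqP := sqr_enorm v; rewrite v0 expr0n/= eq_sym psumr_eq0.
  by move=> /allP/(_ i (mem_index_enum _)); rewrite sqrf_eq0 => /eqP.
by move=> j _; exact: sqr_ge0.
Qed.

Lemma enorm_mktupleZ k (c : R) (v : k.-tuple R) : 0 <= c ->
  enorm [tuple c * tnth v i | i < k] = c * enorm v.
Proof.
move=> c0; rewrite /enorm; under eq_bigr do rewrite tnth_mktuple exprMn.
by rewrite -mulr_sumr sqrtrM ?sqr_ge0// sqrtr_sqr ger0_norm.
Qed.

(** Cauchy-Schwarz inequality. The sum of the squares of [enorm v * tnth u i - enorm u * tnth v i]
    equals [2 * (enorm u * enorm v) * (enorm u * enorm v - D)]; the product of the norms can be
    cancelled unless it is 0, in which case one vector vanishes. *)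
Lemma dot_le_enorm k (u v : k.-tuple R) :
  \sum_(i < k) tnth u i * tnth v i <= enorm u * enorm v.
Proof.
set D := \sum_(i < k) _.
have [AB|] := ltP 0 (enorm u * enorm v); last first.
  rewrite le_eqVlt ltNge mulr_ge0 ?enorm_ge0// orbF => /eqP AB0.
  rewrite AB0; move/eqP: AB0; rewrite mulf_eq0 => /orP[] /eqP/enorm_eq0 e0;
    rewrite /D big1// => i _; by rewrite e0 ?mul0r ?mulr0.
rewrite -(ler_pM2l AB).
have : 0 <= \sum_(i < k) (enorm v * tnth u i - enorm u * tnth v i) ^+ 2.
  by apply: sumr_ge0 => i _; exact: sqr_ge0.
rewrite (eq_bigr (fun i => enorm v ^+ 2 * tnth u i ^+ 2 +
  enorm u ^+ 2 * tnth v i ^+ 2 - (2 * (enorm u * enorm v)) * (tnth u i * tnth v i))).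
  rewrite sumrB big_split/= -!mulr_sumr -!sqr_enorm -/D; nra.
by move=> i _; ring.
Qed.

Lemma enorm_triangle k (u v : k.-tuple R) :
  enorm [tuple tnth u i + tnth v i | i < k] <= enorm u + enorm v.
Proof.
rewrite -(ler_pXn2r (n := 2))// ?nnegrE ?addr_ge0 ?enorm_ge0// sqrrD !sqr_enorm.
under eq_bigr do rewrite tnth_mktuple sqrrD.
rewrite !big_split/= lerD2r lerD2l.
by rewrite mulr2n lerD// dot_le_enorm.
Qed.

Lemma measurable_enorm k : measurable_fun setT (@enorm R k).
Proof.
apply: measurableT_comp => /=.
  by apply: continuous_measurable_fun; exact: sqrt_continuous.
by apply: measurable_sum => i; apply: measurable_funX; exact: measurable_tnth.
Qed.

End enorm_theory.

(** Bernoulli's inequality, which later replaces the [k]-th powers in the moment bounds by linear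
    terms. *)
Lemma bernoulli_le (R : realType) (x : R) n : -1 <= x -> 1 + n%:R * x <= (1 + x) ^+ n.
Proof.
move=> x1; elim: n => [|n IH]; first by rewrite mul0r addr0 expr0.
have x10 : 0 <= 1 + x by lra.
rewrite exprS; apply: le_trans (ler_wpM2l x10 IH).
by rewrite -natr1 -subr_ge0; have := mulr_ge0 (ler0n R n) (sqr_ge0 x); nra.
Qed.

(** * Translation and moments of the spherical Laplace density *)

Section spherical_laplace_theory.
Context {R : realType} (k : nat).
Let L := @lebesgue_tuple R k.
Local Notation N := (\int[L]_y expR (- enorm y)).

Lemma measurable_expR_enorm (c : R) :
  measurable_fun setT (fun z : k.-tuple R => expR (c * enorm z)).
Proof.
apply: measurableT_comp; first exact: measurable_expR.
by apply: measurable_funM => //; exact: measurable_enorm.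
Qed.

Lemma measurable_slap_density : measurable_fun setT (@slap_density R k).
Proof.
apply: measurable_funM => //.
by under eq_fun do rewrite -mulN1r; exact: measurable_expR_enorm.
Qed.

Lemma slap_norm_ge0 : 0 <= N.
Proof. by apply: Rintegral_ge0 => y _; exact: expR_ge0. Qed.

Lemma slap_density_ge0 (z : k.-tuple R) : 0 <= slap_density z.
Proof. by rewrite mulr_ge0 ?expR_ge0 ?invr_ge0 ?slap_norm_ge0. Qed.

(* Were the integral of [expR (- enorm y)] infinite, its real value would be the
   junk 0, the density would vanish, and the total mass could not be 1. *)
Lemma slap_norm_gt0 : slap [set: k.-tuple R] = 1%E -> 0 < N.
Proof.
move=> slap1; rewrite lt_neqAle slap_norm_ge0 andbT.
apply/eqP => N0; move: slap1; rewrite /slap; under eq_integral => z _.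
  by rewrite /slap_density -N0 invr0 mulr0; over.
by rewrite integral0 => /eqP; rewrite eq_sym onee_eq0.
Qed.

Local Open Scope ereal_scope.

(** The core of the privacy bound. Translation invariance moves the shift from the event to the
    density, and [enorm y <= enorm (tsub y v) + enorm v] bounds the shifted density pointwise by
    [expR (enorm v)] times the original one. *)
Lemma slap_translate (v : k.-tuple R) (A : set (k.-tuple R)) : measurable A ->
  slap [set z | A [tuple (tnth z i + tnth v i)%R | i < k]] <=
    (expR (enorm v))%:E * slap A.
Proof.
move=> mA; rewrite /slap.
pose F := (fun y => (slap_density (tsub y v))%:E) \_ A.
have tsubE : (fun y => tsub y v) =
    (fun y => [tuple (1 * tnth y i + tnth [tuple - tnth v i | i < k] i)%R | i < k]).
  apply/funext => y; apply: eq_from_tnth => i.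
  by rewrite !tnth_mktuple mul1r.
have mF : measurable_fun setT F.
  apply/(measurable_restrictT _ _).1 => //; apply: measurable_funTS.
  apply/measurable_EFinP; apply: measurableT_comp; first exact: measurable_slap_density.
  by rewrite tsubE; exact: measurable_tuple_affine.
have F0 y : 0 <= F y.
  by apply: erestrict_ge0 => z _; rewrite lee_fin slap_density_ge0.
apply: (@le_trans _ _ (\int[@lebesgue_tuple R k]_y F y)).
  have := ge0_integral_tuple_affine v ltr01 mF F0.
  rewrite expr1n invr1 mul1e => <-.
  rewrite [leLHS]integral_mkcond le_eqVlt; apply/orP; left; apply/eqP.
  apply: eq_integral => z _; rewrite /F !patchE.
  have -> : [tuple (1 * tnth z i + tnth v i)%R | i < k] =
            [tuple (tnth z i + tnth v i)%R | i < k].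
    by apply: eq_from_tnth => i; rewrite !tnth_mktuple mul1r.
  congr (if _ then (slap_density _)%:E else _).
  by apply: eq_from_tnth => i; rewrite !tnth_mktuple addrK.
rewrite [X in _ * X]integral_mkcond -ge0_integralZl_EFin ?expR_ge0//; last 2 first.
- by move=> z _; apply: erestrict_ge0 => y _; rewrite lee_fin slap_density_ge0.
- apply/(measurable_restrictT _ _).1 => //; apply: measurable_funTS.
  by apply/measurable_EFinP; exact: measurable_slap_density.
apply: ge0_le_integral => //.
- apply: measurable_funeM.
  apply/(measurable_restrictT _ _).1 => //; apply: measurable_funTS.
  by apply/measurable_EFinP; exact: measurable_slap_density.
move=> y _; rewrite /F !patchE; case: ifPn => _; last by rewrite mule0.
rewrite -EFinM lee_fin /slap_density mulrA ler_wpM2r ?invr_ge0 ?slap_norm_ge0//.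
rewrite -expRD ler_expR lerNl opprD opprK addrC lerBlDr.
have := enorm_triangle (tsub y v) v; rewrite (_ : [tuple _ | _ < _] = y)//.
by apply: eq_from_tnth => i; rewrite !tnth_mktuple subrK.
Qed.

Hypothesis N_gt0 : (0 < N)%R.

(** The norm is homogeneous, so [expR (- c * enorm z)] is [expR (- enorm y)] at [y = c z], and the
    change of variables gives the factor [c ^- k]. *)
Lemma laplace_transform_enorm (c : R) : (0 < c)%R ->
  \int[L]_z (expR (- c * enorm z))%:E = (c ^- k * N)%:E.
Proof.
move=> c0; have := @ge0_integral_tuple_affine R k c [tuple 0%R | i < k]
  (fun z => (expR (- enorm z))%:E) c0.
(* The extended integral is finite: an infinite one would have real value 0, against [N_gt0]. *)
rewrite EFinM fineK; last first.
  by move: N_gt0; rewrite /Rintegral; case: integral => //=; rewrite ltxx.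
move=> <-.
- apply: eq_integral => z _; rewrite mulNr -(enorm_mktupleZ _ (ltW c0)).
  congr (expR (- enorm _))%:E; apply: eq_from_tnth => i.
  by rewrite !tnth_mktuple addr0.
- apply/measurable_EFinP; under eq_fun do rewrite -mulN1r.
  exact: measurable_expR_enorm.
- by move=> z; rewrite lee_fin expR_ge0.
Qed.

(** Multiplying the density by [expR (s * enorm z)] only changes its rate from 1 to [1 - s]. *)
Lemma exponential_moment_slap (s : R) : (s < 1)%R ->
  \int[L]_z (expR (s * enorm z) * slap_density z)%:E = ((1 - s) ^- k)%:E.
Proof.
move=> s1; transitivity (\int[L]_z (N^-1%:E * (expR (- (1 - s) * enorm z))%:E)).
  apply: eq_integral => z _; rewrite -EFinM /slap_density mulrA -expRD mulrC.
  by congr (_ * expR _)%:E; ring.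
rewrite ge0_integralZl//.
- rewrite laplace_transform_enorm ?subr_gt0// -EFinM mulrCA mulVf ?mulr1//.
  by rewrite gt_eqF.
- by apply/measurable_EFinP; exact: measurable_expR_enorm.
- by rewrite lee_fin invr_ge0 slap_norm_ge0.
Qed.

Lemma integral_slap_density : \int[L]_z (slap_density z)%:E = 1.
Proof.
have := @exponential_moment_slap 0 ltr01; rewrite subr0 expr1n invr1 => <-.
by apply: eq_integral => z _; rewrite mul0r expR0 mul1r.
Qed.

Lemma measurable_enorm_density :
  measurable_fun setT (fun z : k.-tuple R => enorm z * slap_density z)%R.
Proof.
apply: measurable_funM; first exact: measurable_enorm.
exact: measurable_slap_density.
Qed.

(* Since [1 + t r <= expR (t r)] and [1 - t r <= expR (- t r)], the first moment
   lies between the difference quotients at 0 of the exponential moments. *)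
Lemma mean_enorm_slap :
  \int[L]_z (enorm z * slap_density z)%:E = k%:R%:E.
Proof.
set I := \int[L]_z _.
have I0 : 0 <= I.
  by apply: integral_ge0 => z _; rewrite lee_fin mulr_ge0 ?enorm_ge0 ?slap_density_ge0.
have expm s := measurable_funM (measurable_expR_enorm s) measurable_slap_density.
have h0 := slap_density_ge0.
(* [I] is not yet known to be finite, so sums are formed in the extended reals, with nonnegative
   integrands. *)
have affI t (g : k.-tuple R -> R) : (0 < t)%R -> measurable_fun setT g ->
    (forall z, 0 <= g z)%R ->
    t%:E * I + \int[L]_z (g z)%:E =
    \int[L]_z (t * (enorm z * slap_density z) + g z)%:E.
  move=> t0 mg g0; have mI := measurable_enorm_density.
  have I0' (z : k.-tuple R) : (0 <= enorm z * slap_density z)%R.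
    by rewrite mulr_ge0 ?enorm_ge0 ?h0.
  rewrite -ge0_integralZl_EFin ?(ltW t0)//; last exact/measurable_EFinP.
  rewrite -ge0_integralD//.
  - by move=> z _; rewrite -EFinM lee_fin mulr_ge0// ltW.
  - by apply: measurable_funeM; exact/measurable_EFinP.
  - by move=> z _; rewrite lee_fin.
  - exact/measurable_EFinP.
  - by move=> z _; rewrite lee_fin.
have maffI t (g : k.-tuple R -> R) : measurable_fun setT g ->
    measurable_fun setT (fun z => t * (enorm z * slap_density z) + g z)%R.
  move=> mg; apply: measurable_funD => //.
  by apply: measurable_funM => //; exact: measurable_enorm_density.
have ub t : (0 < t < 1)%R -> t%:E * I + 1 <= ((1 - t) ^- k)%:E.
  move=> /andP[t0 t1]; rewrite -exponential_moment_slap// -integral_slap_density.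
  rewrite affI//; last exact: measurable_slap_density.
  apply: ge0_le_integral => //.
  - by move=> z _; rewrite lee_fin addr_ge0 ?h0// mulr_ge0 ?(ltW t0)// mulr_ge0 ?enorm_ge0.
  - by apply/measurable_EFinP; apply: maffI; exact: measurable_slap_density.
  - by apply/measurable_EFinP; exact: expm.
  - move=> z _; rewrite lee_fin mulrA -[X in (_ + X)%R]mul1r -mulrDl.
    by rewrite ler_wpM2r// addrC expR_ge1Dx.
have lb t : (0 < t)%R -> 1 <= t%:E * I + ((1 + t) ^- k)%:E.
  move=> t0; have -> : ((1 + t) ^- k = (1 - - t) ^- k)%R by rewrite opprK.
  have tN1 : (- t < 1)%R by lra.
  rewrite -exponential_moment_slap// -[leLHS]integral_slap_density.
  rewrite (affI _ _ t0 (expm (- t)%R)); last first.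
    by move=> z; rewrite mulr_ge0 ?expR_ge0.
  apply: ge0_le_integral => //.
  - by move=> z _; rewrite lee_fin.
  - by apply/measurable_EFinP; exact: measurable_slap_density.
  - by apply/measurable_EFinP; apply: maffI; exact: expm.
  - move=> z _; rewrite lee_fin mulrA -mulrDl ler_peMl// -lerBlDl -mulNr.
    exact: expR_ge1Dx.
clear affI; clearbody I.
(* The upper bound at [t = 1/2] already excludes an infinite mean. *)
have Ifin : I \is a fin_num.
  have {ub lb}u : 2^-1%:E * I + 1 <= ((1 - 2^-1) ^- k)%:E by apply: ub; lra.
  rewrite ge0_fin_numE//; case: I I0 u => [r _ _|_|//]; first exact: ltry.
  by rewrite gt0_muley// lte_fin invr_gt0.
rewrite -(fineK Ifin) in I0 ub lb *; congr _%:E.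
set i := fine I in I0 ub lb *.
have i0 : (0 <= i)%R by [].
(* Letting [t] tend to 0 gives [i = k%:R]. For a given error [e], [t] is at most
   [e / (k%:R * i + 1)], where the added 1 keeps the denominator positive. *)
suff close t : (0 < t < 1)%R -> (`|i - k%:R| <= k%:R * i * t)%R.
  apply/eqP; rewrite -subr_eq0 -normr_le0; apply/ler_addgt0Pl => e e0.
  rewrite addr0; pose t : R := (Num.min 2^-1 (e / (k%:R * i + 1)))%R.
  have ki0 : (0 <= k%:R * i)%R by rewrite mulr_ge0.
  have d0 : (0 < k%:R * i + 1)%R by lra.
  have t01 : (0 < t < 1)%R.
    by rewrite lt_min invr_gt0 ltr0n/= divr_gt0//= gt_min; apply/orP; left; lra.
  apply: le_trans (close t t01) _.
  apply: (@le_trans _ _ ((k%:R * i + 1) * t)%R); first nra.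
  by rewrite -ler_pdivlMl// mulrC ge_min lexx orbT.
move=> /andP[t0 t1]; have t01 : (0 < t < 1)%R by rewrite t0.
(* With Bernoulli at [- t] and [t], the two bounds become [(t * i + 1) * (1 - k%:R * t) <= 1] and
   [(1 - t * i) * (1 + k%:R * t) <= 1]; expanding and dividing by [t] gives the two sides of the
   estimate. *)
have b1 := @bernoulli_le R (- t) k; have b2 := @bernoulli_le R t k.
have p1 : (0 < (1 - t) ^+ k)%R by rewrite exprn_gt0// subr_gt0.
have p2 : (0 < (1 + t) ^+ k)%R by rewrite exprn_gt0// addr_gt0.
have u := ub t t01; have l := lb t t0.
rewrite -EFinM -EFinD lee_fin -[leRHS]div1r ler_pdivlMr// in u.
rewrite -EFinM -EFinD lee_fin -lerBlDl -[leRHS]div1r ler_pdivlMr// in l.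
have k0 : (0 <= k%:R :> R)%R by [].
have {}b1 : (1 - k%:R * t <= (1 - t) ^+ k)%R by rewrite -mulrN b1//; lra.
have {}b2 : (1 + k%:R * t <= (1 + t) ^+ k)%R by rewrite b2//; lra.
have ti0 : (0 <= t * i)%R by rewrite mulr_ge0// ltW.
rewrite ler_norml; apply/andP; split; last first.
  have u1 : ((t * i + 1) * (1 - k%:R * t) <= 1)%R.
    by apply: le_trans u; rewrite ler_wpM2l// addr_ge0.
  by rewrite -(ler_pM2l t0); nra.
(* Multiplying by [1 - t * i] requires it to be nonnegative; when [t * i > 1], the estimate follows
   from [k%:R <= k%:R * i * t]. *)
have [ti1|ti1] := leP (t * i)%R 1%R; last first.
  have : (k%:R * 1 <= k%:R * (t * i))%R by rewrite ler_wpM2l// ltW.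
  by rewrite mulrA mulr1 mulrAC; lra.
have l1 : ((1 - t * i) * (1 + k%:R * t) <= 1)%R.
  by apply: le_trans l; rewrite ler_wpM2l// subr_ge0.
by rewrite -(ler_pM2l t0); nra.
Qed.

End spherical_laplace_theory.

(** * Mean and tail of the norm of a spherical Laplace variable *)

Section slap_random_variable.
Context {R : realType} (k : nat).
Context (dO : measure_display) (Omega : measurableType dO) (P : probability Omega R).
Context (Z : {RV P >-> k.-tuple R}).
Hypothesis ZE : forall A : set (k.-tuple R), measurable A ->
  distribution P Z A = slap A.
Local Open Scope ereal_scope.

(** The law of [Z] is a probability, so [slap] has total mass 1; this yields the normalisation
    without computing the integral. *)
Let N_gt0 : (0 < \int[@lebesgue_tuple R k]_y expR (- enorm y))%R.
Proof. by apply: slap_norm_gt0; rewrite -ZE// probability_setT. Qed.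

Lemma expectation_slap (f : k.-tuple R -> R) : measurable_fun setT f ->
  (forall z, (0 <= f z)%R) ->
  'E_P[fun w => f (Z w)] =
  \int[@lebesgue_tuple R k]_z (f z * slap_density z)%:E.
Proof.
move=> mf f0; rewrite unlock -[LHS]/(\int[P]_w ((EFin \o f) \o Z) w).
rewrite -ge0_integral_distribution//; last exact/measurable_EFinP.
have nuE A : measurable A -> distribution P Z A =
  \int[@lebesgue_tuple R k]_(z in A) (slap_density z)%:E by exact: ZE.
rewrite (ge0_integral_density (@measurable_slap_density R k) _ nuE)//.
- by move=> z; exact: slap_density_ge0.
- exact/measurable_EFinP.
Qed.

Lemma expectation_enorm_slap (c : R) : (0 <= c)%R ->
  'E_P[fun w => (c * enorm (Z w))%R] = (c * k%:R)%:E.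
Proof.
move=> c0; rewrite (@expectation_slap (fun z => c * enorm z)%R); last 2 first.
- by apply: measurable_funM => //; exact: measurable_enorm.
- by move=> z; rewrite mulr_ge0 ?enorm_ge0.
under eq_integral do rewrite -mulrA EFinM.
rewrite ge0_integralZl_EFin//; last 2 first.
- by move=> z _; rewrite lee_fin mulr_ge0 ?enorm_ge0 ?slap_density_ge0.
- by apply/measurable_EFinP; exact: measurable_enorm_density.
by rewrite mean_enorm_slap.
Qed.

Lemma measurable_enorm_le (r : R) : measurable [set z : k.-tuple R | (enorm z <= r)%R].
Proof.
rewrite (_ : mkset _ = @enorm R k @^-1` `]-oo, r]%classic).
  by rewrite -[X in measurable X]setTI; exact: measurable_enorm.
by apply/seteqP; split => z /=; rewrite in_itv.
Qed.

(* Chernoff's bound with exponent [s = 1 - 1 / e]: the moment [(1 - s) ^- k] is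
   then [e ^ k], which is where the constant [e / (e - 1)] of [eta1] comes from. *)
Lemma enorm_slap_tail (beta : R) : (0 < beta < 1)%R ->
  (1 - beta)%:E <= P [set w | (enorm (Z w) <= eta1 beta k)%R].
Proof.
move=> /andP[b0 b1]; set r := eta1 beta k.
pose s : R := (1 - expR (- 1))%R.
have e1 : (1 < expR 1 :> R)%R by rewrite expR_gt1.
(* The factor [s = (e - 1) / e] cancels the constant of [eta1]. *)
have sr : (s * r = k%:R - ln beta)%R.
  rewrite /s /r /eta1 expRN div1r lnV ?posrE//; field.
  by rewrite subr_eq0 !gt_eqF// (lt_trans _ e1).
rewrite -[X in P X]/(Z @^-1` [set z | enorm z <= r]%R).
rewrite -[leRHS]/(distribution P Z _).
rewrite -(setCK [set z | _]) probability_setC; last first.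
  by apply: measurableC; exact: measurable_enorm_le.
rewrite EFinB leeB//.
rewrite -[leLHS]/(distribution P Z _) ZE; last by apply: measurableC; exact: measurable_enorm_le.
(* Since [1 - s = expR (- 1)], the right-hand side is [expR (ln beta - k%:R)] times
   [expR 1 ^+ k]. *)
have -> : beta%:E = (expR (- (s * r)) * ((1 - s) ^- k))%:E.
  rewrite sr opprB subKr -expRM_natl -expRN -expRD mulrN1 opprK subrK.
  by rewrite lnK.
rewrite EFinM -exponential_moment_slap//; last by rewrite gtrBl expR_gt0.
rewrite -ge0_integralZl_EFin ?expR_ge0//; last 2 first.
- by move=> z _; rewrite lee_fin mulr_ge0 ?expR_ge0 ?slap_density_ge0.
- apply/measurable_EFinP; apply: measurable_funM; last exact: measurable_slap_density.
  exact: measurable_expR_enorm.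
rewrite /slap [leLHS]integral_mkcond; apply: ge0_le_integral => //.
- by move=> z _; apply: erestrict_ge0 => y _; rewrite lee_fin slap_density_ge0.
- apply/(measurable_restrictT _ _).1; first by apply: measurableC; exact: measurable_enorm_le.
  by apply: measurable_funTS; apply/measurable_EFinP; exact: measurable_slap_density.
- apply: measurable_funeM.
  apply/measurable_EFinP; apply: measurable_funM; last exact: measurable_slap_density.
  exact: measurable_expR_enorm.
(* Markov's argument: the weight [expR (s * (enorm z - r))] is nonnegative everywhere and at least 1
   where [enorm z > r]. *)
move=> z _; rewrite patchE -EFinM mulrA -expRD; case: ifPn => [|_]; last first.
  by rewrite lee_fin mulr_ge0 ?expR_ge0 ?slap_density_ge0.
rewrite inE /= => /negP; rewrite -ltNge => rz.
rewrite lee_fin ler_peMl ?slap_density_ge0// -[leLHS]expR0 ler_expR.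
have s0 : (0 <= s)%R by rewrite subr_ge0 -[leRHS]expR0 ler_expR; lra.
by rewrite addrC -mulrBr mulr_ge0// subr_ge0 ltW.
Qed.

End slap_random_variable.

(** * Gram matrices *)

Section Rintegral_sum.
Context d (T : measurableType d) (R : realType) (mu : {measure set T -> \bar R}).
Context (D : set T) (mD : measurable D) (I : Type) (s : seq I) (f : I -> T -> R).
Hypothesis intf : forall i, mu.-integrable D (EFin \o f i).

Lemma integrable_EFin_sum :
  mu.-integrable D (EFin \o (fun t => \sum_(i <- s) f i t)).
Proof.
rewrite (_ : _ \o _ = (fun t => \sum_(i <- s) (f i t)%:E)%E).
  by apply: (integrable_sum mD) => i _; exact: intf.
by apply/funext => t /=; rewrite sumEFin.
Qed.

Lemma Rintegral_sum : \int[mu]_(t in D) (\sum_(i <- s) f i t) =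
  \sum_(i <- s) \int[mu]_(t in D) f i t.
Proof.
rewrite /Rintegral; under eq_integral do rewrite -sumEFin.
rewrite integral_sum//.
by rewrite -sum_fine// => i _; apply: integrable_fin_num => //; exact: intf.
Qed.
End Rintegral_sum.

Section gram_real_coefficients.
Context {R : realType} {d n m : nat} (I : set (d.-tuple R)).
Context (phi : 'I_m -> d.-tuple R -> n.-tuple R).
Let mu := @lebesgue_tuple R d.
Let b := RealCoef phi.
Hypotheses (mI : measurable I) (sqi : square_integrable I b).

Lemma measurable_basis j r : measurable_fun I (fun t => tnth (phi j t) r).
Proof.
by have [mphi _] := sqi j; apply: (measurableT_comp (measurable_tnth r)).
Qed.

Lemma integrable_sqr_enorm j : mu.-integrable I (fun t => (enorm (phi j t) ^+ 2)%:E).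
Proof.
have [mphi phioo] := sqi j; apply/integrableP; split.
  apply/measurable_EFinP; apply: measurable_funX.
  exact: (measurableT_comp (@measurable_enorm R n)).
by under eq_integral do rewrite gee0_abs ?lee_fin ?sqr_ge0//.
Qed.

(** Domination: [|x * y| <= x ^+ 2 + y ^+ 2], and the square of a coordinate is at most the squared
    norm. *)
Lemma integrable_basis_prod j l r :
  mu.-integrable I (EFin \o (fun t => tnth (phi j t) r * tnth (phi l t) r)).
Proof.
apply: (le_integrable mI _ _
  (integrableD mI (integrable_sqr_enorm j) (integrable_sqr_enorm l))).
  by apply/measurable_EFinP; apply: measurable_funM; exact: measurable_basis.
have sqr_tnth (v : n.-tuple R) : tnth v r ^+ 2 <= enorm v ^+ 2.
  rewrite sqr_enorm (bigD1 r)//= lerDl sumr_ge0// => i _; exact: sqr_ge0.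
move=> t _ /=; rewrite lee_fin [leRHS]ger0_norm ?addr_ge0 ?sqr_ge0//.
apply: le_trans (lerD (sqr_tnth _) (sqr_tnth _)).
by rewrite ler_norml; apply/andP; split; nra.
Qed.

Lemma sqr_enorm_comb (a : m.-tuple R) t : enorm (comb (b := b) a t) ^+ 2 =
  \sum_(j < m) \sum_(l < m) tnth a j * tnth a l *
    \sum_(r < n) tnth (phi j t) r * tnth (phi l t) r.
Proof.
rewrite sqr_enorm; under eq_bigr => r _.
  rewrite tnth_mktuple expr2 big_distrlr/=; over.
rewrite exchange_big/=; apply: eq_bigr => j _.
rewrite exchange_big/=; apply: eq_bigr => l _.
by rewrite mulr_sumr; apply: eq_bigr => r _; rewrite mulrACA.
Qed.

Let integrable_dot j l : mu.-integrable I
  (EFin \o (fun t => \sum_(r < n) tnth (phi j t) r * tnth (phi l t) r)).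
Proof. by apply: integrable_EFin_sum => // r; exact: integrable_basis_prod. Qed.

Let integrable_dotZ (c : R) j l : mu.-integrable I
  (EFin \o (fun t => c * \sum_(r < n) tnth (phi j t) r * tnth (phi l t) r)).
Proof. exact: (integrableZl mI c (integrable_dot j l)). Qed.

Lemma integrable_sqr_enorm_comb (a : m.-tuple R) :
  mu.-integrable I (EFin \o (fun t => enorm (comb (b := b) a t) ^+ 2)).
Proof.
under eq_fun do rewrite sqr_enorm_comb.
by apply: integrable_EFin_sum => // j; apply: integrable_EFin_sum => // l.
Qed.

Lemma Rintegral_sqr_enorm_comb (a : m.-tuple R) :
  \int[mu]_(t in I) (enorm (comb (b := b) a t) ^+ 2) =
  ((\col_j tnth a j)^T *m gram I b *m \col_j tnth a j) 0 0.
Proof.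
under eq_Rintegral do rewrite sqr_enorm_comb.
rewrite Rintegral_sum//; last first.
  by move=> j; apply: integrable_EFin_sum => // l.
rewrite mxE; under [RHS]eq_bigr do rewrite mxE mulr_suml.
rewrite exchange_big/=; apply: eq_bigr => j _.
rewrite Rintegral_sum//; apply: eq_bigr => l _.
rewrite RintegralZl// Rintegral_sum//; last by move=> r; exact: integrable_basis_prod.
by rewrite !mxE mulrAC.
Qed.

(** The form at [v] is the integral over [I] of the squared norm of the combination with
    coefficients [v]. If it is 0, the combination vanishes almost everywhere on [I], and linear
    independence gives [v = 0]. *)
Lemma gram_posdef : lin_indep I b -> posdefmx (gram I b).
Proof.
move=> indep; split.
  apply/matrixP => j l; rewrite !mxE; apply: eq_bigr => r _.
  by apply: eq_Rintegral => t _; rewrite mulrC.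
move=> v v0; pose a := [tuple v i 0 | i < m].
have -> : v = \col_j tnth a j by apply/matrixP => i j; rewrite mxE tnth_mktuple ord1.
rewrite -Rintegral_sqr_enorm_comb lt_neqAle Rintegral_ge0 ?andbT; last first.
  by move=> t _; exact: sqr_ge0.
apply: contra v0 => /eqP/esym int0; apply/eqP/matrixP => i j; rewrite ord1 mxE.
have := indep (fun i => v i 0); apply => {i j}.
have inta := integrable_sqr_enorm_comb a.
have : (\int[mu]_(t in I) `|(enorm (comb (b := b) a t) ^+ 2)%:E| = 0)%E.
  under eq_integral do rewrite gee0_abs ?lee_fin ?sqr_ge0//.
  by rewrite -(fineK (integrable_fin_num mI inta)); congr _%:E.
move=> /(ae_eq_integral_abs _ mI (measurable_int _ inta)).
apply: filterS => t /[apply] /= [[]] /eqP; rewrite sqrf_eq0 => /eqP /enorm_eq0 e0 r.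
have := e0 r; rewrite tnth_mktuple; apply: etrans; apply: eq_bigr => l _.
by rewrite tnth_mktuple.
Qed.

Lemma dist2_comb (a a' : m.-tuple R) : dist2 I (comb (b := b) a) (comb (b := b) a') =
  Num.sqrt (((\col_j tnth (tsub a a') j)^T *m gram I b *m
    \col_j tnth (tsub a a') j) 0 0).
Proof.
rewrite -Rintegral_sqr_enorm_comb; congr Num.sqrt; apply: eq_Rintegral => t _.
congr (enorm _ ^+ 2); apply: eq_from_tnth => r; rewrite !tnth_mktuple -sumrB.
by apply: eq_bigr => j _; rewrite tnth_mktuple mulrBl.
Qed.
End gram_real_coefficients.

(** * Reduction of vector coefficients to real coefficients *)

Section vector_coefficients.
Context {R : realType} {d n m : nat} (I : set (d.-tuple R)).
Context (phi : 'I_m -> d.-tuple R -> R).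

(* Vector coefficients are real coefficients with respect to the basis functions
   [phi j] times the [r]-th vector of the canonical basis. *)
Definition scalar_basis (p : 'I_(n * m)) (t : d.-tuple R) : n.-tuple R :=
  [tuple if r == (mxtens_unindex p).1 then phi (mxtens_unindex p).2 t else 0 | r < n].

Lemma tnth_scalar_basis r j t r' :
  tnth (scalar_basis (mxtens_index (r, j)) t) r' = if r' == r then phi j t else 0.
Proof. by rewrite tnth_mktuple mxtens_indexK. Qed.

Lemma sum_scalar_basis (a : 'I_(n * m) -> R) t r :
  \sum_p a p * tnth (scalar_basis p t) r = \sum_(j < m) a (mxtens_index (r, j)) * phi j t.
Proof.
rewrite (reindex (@mxtens_index n m)); last first.
  by exists (@mxtens_unindex n m) => p _; rewrite ?mxtens_indexK ?mxtens_unindexK.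
rewrite (eq_bigr (fun q => (fun r' j =>
  if r' == r then a (mxtens_index (r', j)) * phi j t else 0) q.1 q.2)); last first.
  move=> [r' j] _ /=; rewrite tnth_scalar_basis eq_sym.
  by case: ifP; rewrite ?mulr0.
rewrite -(pair_bigA _ (fun r' j =>
  if r' == r then a (mxtens_index (r', j)) * phi j t else 0))/= (bigD1 r)//= eqxx.
by rewrite [X in _ + X]big1 ?addr0// => r' /negbTE ->; rewrite big1.
Qed.

Lemma comb_scalar_basis (a : (n * m).-tuple R) :
  comb (b := @VectorCoef R d n m phi) a = comb (b := RealCoef scalar_basis) a.
Proof.
apply/funext => t; apply: eq_from_tnth => r.
by rewrite !tnth_mktuple sum_scalar_basis.
Qed.

Lemma square_integrable_scalar_basis :
  square_integrable I (@VectorCoef R d n m phi) ->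
  square_integrable I (RealCoef scalar_basis).
Proof.
move=> sqi p; have [mphi phioo] := sqi (mxtens_unindex p).2; split.
  pose g (x : R) := [tuple if r == (mxtens_unindex p).1 then x else 0 | r < n].
  apply: (measurableT_comp (f := g)) mphi; apply/measurable_fun_tnthP => r.
  rewrite (_ : _ \o g = fun x => if r == (mxtens_unindex p).1 then x else 0).
    by case: (r == _).
  by apply/funext => x /=; rewrite tnth_mktuple.
apply: le_lt_trans phioo; rewrite le_eqVlt; apply/orP; left; apply/eqP.
apply: eq_integral => t _; congr _%:E.
rewrite sqr_enorm (bigD1 (mxtens_unindex p).1)//= tnth_mktuple eqxx.
by rewrite big1 ?addr0// => r /negbTE rp; rewrite tnth_mktuple rp expr0n.
Qed.

Lemma lin_indep_scalar_basis :
  lin_indep I (@VectorCoef R d n m phi) -> lin_indep I (RealCoef scalar_basis).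
Proof.
move=> indep c c0 p; case: (mxtens_indexP p) => r j.
apply: (indep (fun j => c (mxtens_index (r, j)))).
by apply: filterS c0 => t /[apply] /(_ r); rewrite sum_scalar_basis.
Qed.

(** Two functions of [scalar_basis] attached to different coordinates have pointwise dot product 0,
    which gives the zero blocks; for the same coordinate [r] only the [r]-th term of the sum
    remains. *)
Lemma gram_scalar_basis :
  gram I (@VectorCoef R d n m phi) = gram I (RealCoef scalar_basis).
Proof.
apply/matrixP => p q; case: (mxtens_indexP p) => r j; case: (mxtens_indexP q) => r' l.
rewrite tensmxE !mxE (bigD1 r)//= big1 ?addr0; last first.
  move=> i /negbTE ir; under eq_Rintegral do rewrite tnth_scalar_basis ir mul0r.
  by rewrite /Rintegral integral0.
under [RHS]eq_Rintegral do rewrite !tnth_scalar_basis eqxx.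
case: eqVneq => _; first by rewrite mul1r.
rewrite mul0r; under eq_Rintegral do rewrite mulr0.
by rewrite /Rintegral integral0.
Qed.
End vector_coefficients.

(** * The mechanism *)

Section mechanism_theory.
Context {R : realType} (k : nat) (G : 'M[R]_k).
Hypothesis Gpd : posdefmx G.
Let S := sqrtmx (invmx G).
Let whiten (u : k.-tuple R) : k.-tuple R :=
  [tuple (invmx S *m \col_j tnth u j) i 0 | i < k].

Let Su : S \in unitmx.
Proof. exact: posdefmx_unit (sqrtmxP (posdefmx_inv Gpd)).1. Qed.

(** From [S *m S = invmx G] and the symmetry of [S], [G] factors as [(invmx S)^T *m invmx S]. *)
Lemma sqrt_qform (u : k.-tuple R) :
  Num.sqrt (((\col_j tnth u j)^T *m G *m \col_j tnth u j) 0 0) = enorm (whiten u).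
Proof.
have [[Ssym _] SS] := sqrtmxP (posdefmx_inv Gpd); rewrite -/S in Ssym SS.
have -> : G = (invmx S)^T *m invmx S.
  have Gu := posdefmx_unit Gpd; apply: (row_full_inj (A := invmx G)).
    by rewrite row_full_unit unitmx_inv.
  by rewrite mulVmx// -[in invmx G]SS trmx_inv Ssym mulmxA mulmxK// mulmxV.
rewrite mulmxA -trmx_mul -mulmxA mxE; congr Num.sqrt; apply: eq_bigr => i _.
by rewrite tnth_mktuple mxE expr2.
Qed.

(** Such a distance is the Euclidean one pulled back along the injective linear map [invmx S]. *)
Lemma qform_metric (dist : k.-tuple R -> k.-tuple R -> R) :
  (forall a a', dist a a' = enorm (whiten (tsub a a'))) -> is_metric dist.
Proof.
move=> distE; split=> [a a'|a a'|a a'|a1 a2 a3].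
- by rewrite distE enorm_ge0.
- rewrite distE; split=> [/enorm_eq0 u0|->].
    have : invmx S *m \col_j tnth (tsub a a') j = 0.
      apply/matrixP => i j; rewrite ord1.
      by have := u0 i; rewrite tnth_mktuple => ->; rewrite mxE.
    move=> /(congr1 (mulmx S)); rewrite mulKVmx// mulmx0 => /matrixP d0.
    apply: eq_from_tnth => i; have := d0 i 0.
    by rewrite !mxE tnth_mktuple => /eqP; rewrite subr_eq0 => /eqP.
  rewrite /enorm big1 ?sqrtr0// => i _; rewrite tnth_mktuple.
  rewrite (_ : \col_j _ = 0) ?mulmx0 ?mxE ?expr0n//.
  by apply/matrixP => p q; rewrite !mxE tnth_mktuple subrr.
- rewrite !distE /enorm; congr Num.sqrt; apply: eq_bigr => i _.
  rewrite !tnth_mktuple -sqrrN; congr (_ ^+ 2).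
  rewrite (_ : \col_j tnth (tsub a' a) j = - \col_j tnth (tsub a a') j).
    by rewrite mulmxN [RHS]mxE.
  by apply/matrixP => p q; rewrite !mxE !tnth_mktuple opprB.
- rewrite !distE; apply: le_trans (enorm_triangle _ _).
  rewrite le_eqVlt; apply/orP; left; apply/eqP; congr enorm.
  apply: eq_from_tnth => i; rewrite !tnth_mktuple.
  rewrite (_ : \col_j tnth (tsub a1 a3) j =
      \col_j tnth (tsub a1 a2) j + \col_j tnth (tsub a2 a3) j).
    by rewrite mulmxDr [LHS]mxE.
  by apply/matrixP => p q; rewrite !mxE !tnth_mktuple addrA subrK.
Qed.

Variables (eps : R) (eps0 : 0 < eps).

(** [invmx S] undoes the shaping of the noise, so the error measured in [dist] depends only on the
    norm of [z]. *)
Lemma whiten_perturb (a z : k.-tuple R) :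
  whiten (tsub (perturb eps S a z) a) = [tuple eps^-1 * tnth z i | i < k].
Proof.
apply: eq_from_tnth => i; rewrite !tnth_mktuple.
rewrite (_ : \col_j tnth (tsub _ a) j = eps^-1 *: (S *m \col_j tnth z j)).
  by rewrite -scalemxAr mulKmx// !mxE.
by apply/matrixP => p q; rewrite ord1 !mxE !tnth_mktuple addrAC subrr add0r !mxE.
Qed.

(** The term [eps^-1 * S] sends the added vector [eps * invmx S (a - a')] to [a - a'], so a change
    of input becomes a translation of the noise. *)
Lemma perturb_translate (a a' z : k.-tuple R) :
  perturb eps S a z = perturb eps S a'
    [tuple tnth z i + tnth [tuple eps * tnth (whiten (tsub a a')) i | i < k] i | i < k].
Proof.
apply: eq_from_tnth => i; rewrite !tnth_mktuple.
rewrite (_ : \col_j tnth [tuple _ | _ < _] j =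
  \col_j tnth z j + eps *: (invmx S *m \col_j tnth (tsub a a') j)).
  rewrite mulmxDr -scalemxAr mulKVmx// !mxE mulrDr mulKf ?gt_eqF//.
  by rewrite tnth_mktuple [in RHS]addrC -addrA subrK addrC.
by apply/matrixP => p q; rewrite ord1 !mxE !tnth_mktuple !mxE.
Qed.

Lemma measurable_perturb (a : k.-tuple R) : measurable_fun setT (perturb eps S a).
Proof.
apply/measurable_fun_tnthP => i.
rewrite (_ : _ \o _ = fun z => tnth a i + eps^-1 * \sum_j (S i j * tnth z j)).
  apply: measurable_funD => //; apply: measurable_funM => //.
  apply: measurable_sum => j; apply: measurable_funM => //.
  exact: measurable_tnth.
apply/funext => z; rewrite /= tnth_mktuple mxE; congr (_ + _ * _).
by apply: eq_bigr => j _; rewrite mxE.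
Qed.

(** Formulated for an arbitrary positive definite [G] and its distance, so that both coefficient
    settings are instances. *)
Lemma slap_mechanism (dist : k.-tuple R -> k.-tuple R -> R)
    (dO : measure_display) (Omega : measurableType dO) (P : probability Omega R)
    (Z : {RV P >-> k.-tuple R}) :
  (forall a a', dist a a' =
    Num.sqrt (((\col_j tnth (tsub a a') j)^T *m G *m \col_j tnth (tsub a a') j) 0 0)) ->
  (forall A : set (k.-tuple R), measurable A -> distribution P Z A = slap A) ->
  let M := fun a w => perturb eps S a (Z w) in
  geo_private P dist M eps /\
  forall a : k.-tuple R,
    ('E_P[fun w => dist (M a w) a] = (k%:R / eps)%:E)%E /\
    forall beta : R, 0 < beta < 1 ->
      ((1 - beta)%:E <= P [set w | (dist (M a w) a <= eta1 beta k / eps)%R])%E.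
Proof.
move=> distE ZE M.
have distW a a' : dist a a' = enorm (whiten (tsub a a')) by rewrite distE sqrt_qform.
have distM a w : dist (M a w) a = eps^-1 * enorm (Z w).
  by rewrite distW whiten_perturb enorm_mktupleZ ?invr_ge0 ?ltW.
have mM a : measurable_fun setT (perturb eps S a \o Z).
  by apply: measurableT_comp => //; exact: measurable_perturb.
split; first split=> //.
- exact: qform_metric.
- move=> a a' A mA.
  pose D x := perturb eps S x @^-1` A.
  have mD x : measurable (D x).
    by rewrite -[X in measurable X]setTI; exact: measurable_perturb.
  have PE x : P (M x @^-1` A) = slap (D x) by rewrite -ZE.
  rewrite !PE.
  pose v := [tuple eps * tnth (whiten (tsub a a')) i | i < k].
  have -> : eps * dist a a' = enorm v.
    by rewrite enorm_mktupleZ ?ltW// distW.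
  rewrite (_ : D a = [set z | D a' [tuple (tnth z i + tnth v i)%R | i < k]]).
    apply: slap_translate (mD a').
  by apply/funext => z; rewrite /D /= (perturb_translate a a').
- move=> a; split.
    under eq_fun do rewrite distM.
    by rewrite (expectation_enorm_slap ZE) ?invr_ge0 ?ltW// mulrC.
  move=> beta beta01; apply: le_trans (enorm_slap_tail ZE beta01) _.
  rewrite le_eqVlt; apply/orP; left; apply/eqP; congr (P _).
  by apply/funext => w /=; rewrite distM mulrC ler_pM2r// invr_gt0.
Qed.
End mechanism_theory.

Unset Implicit Arguments.

Theorem corollary3p1 (R : realType) (d n m : nat) (J : 'I_d -> set R)
  (phi : basis_system R d n m) (eps : R)
  (dO : measure_display) (Omega : measurableType dO) (P : probability Omega R)
  (Z : {RV P >-> (dimU phi).-tuple R}) :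
  (forall i, measurable (J i)) ->
  0 < eps ->
  square_integrable (box J) phi ->
  lin_indep (box J) phi ->
  (forall A : set ((dimU phi).-tuple R), measurable A ->
    distribution P Z A = slap A) ->
  let I := box J in
  let M := fun (a : (dimU phi).-tuple R) (w : Omega) =>
    perturb eps (sqrtmx (Sigma I phi)) a (Z w) in
  let dist := fun a a' : (dimU phi).-tuple R =>
    dist2 I (comb a) (comb a') in
  geo_private P dist M eps /\
  forall a : (dimU phi).-tuple R,
    ('E_P[fun w => dist (M a w) a] = ((dimU phi)%:R / eps)%:E)%E /\
    forall beta : R, 0 < beta < 1 ->
      ((1 - beta)%:E <=
        P [set w | (dist (M a w) a <= eta1 beta (dimU phi) / eps)%R])%E.
Proof.
move=> mJ eps0 sqi indep ZE.
have mI : measurable (box J).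
  rewrite (_ : box J = \bigcap_(i in [set: 'I_d]) (@tnth d R)^~ i @^-1` J i).
    apply: fin_bigcap_measurable => // i _.
    by rewrite -[X in measurable X]setTI; exact: measurable_tnth.
  by apply/seteqP; split=> [t Jt i _|t Jt i]; exact: Jt.
case: phi Z sqi indep ZE => phi Z sqi indep ZE I M dist.
  apply: (slap_mechanism (gram_posdef mI sqi indep) eps0 _ ZE) => a a'.
  exact: dist2_comb.
(* The vector setting becomes the real one for [scalar_basis], with the same Gram matrix and the
   same functions [comb a]. *)
have sqi' := square_integrable_scalar_basis sqi.
have indep' := lin_indep_scalar_basis indep.
rewrite /dist /M /Sigma gram_scalar_basis.
apply: (slap_mechanism (gram_posdef mI sqi' indep') eps0 _ ZE) => a a'.
by rewrite !comb_scalar_basis; exact: dist2_comb.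
Qed.
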